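(* Let $d\ge1$ be an integer. The label process $\underline{x}(t)$ of the $d$ second class particles has reversible stationary distribution $\underline{\pi}$, where $$\underline{\pi}(\underline{x})=\prod_{i=1}^d\left(1-q^i\right)\cdot q^{\sum_{i=1}^d x_i-\frac{d(d-1)}{2}}\qquad\text{for any }\underline{x}\in Z_+^d.$$
   Context: Fix $q\in(0,1)$. $Z_+^d=\{\underline x\in\mathbb{Z}^d:0\le x_1<x_2<\dots<x_d\}$. $\Omega=\{\underline z\in\{0,1\}^{\mathbb{Z}}:\sum_{i\le0}z_i<\infty,\ \sum_{i\ge1}(1-z_i)<\infty\}$. ASEP: the Markov jump process $\underline\xi(t)$ on $\Omega$ in which, for every $i\in\mathbb{Z}$, a particle at $i$ jumps to $i+1$ at rate $1$ if $i+1$ is empty, and a particle at $i+1$ jumps to $i$ at rate $q$ if $i$ is empty. The label of a particle of $\underline\xi(t)$ is the number of particles of $\underline\xi(t)$ strictly to its left; labels are $0,1,2,\dots$. Label process: $\underline x(t)\in Z_+^d$ evolves, given the background $\{\underline\xi(t)\}_{t\ge0}$ (whose own evolution is not influenced by $\underline x$), with the following jump rates. When the background is in state $\underline\xi\in\Omega$, each coordinate $x_j$ becomes $x_j+1$ at rate $q$ if $x_j+1$ is not one of the coordinates of $\underline x$, and becomes $x_j-1$ at rate $1$ if $x_j-1\ge0$ and $x_j-1$ is not one of the coordinates; in either case the move is allowed only if the two particles of $\underline\xi$ whose labels are the old and new values of $x_j$ occupy neighbouring sites. Denote the resulting rate from $\underline x$ to $\underline y$ by $r_{\underline\xi}(\underline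 x,\underline y)$. Equivalently, $\underline x(t)$ gives the particle positions of an ASEP on $\mathbb{Z}_{\ge0}$ with exactly $d$ particles, closed left boundary, right jump rate $q$ and left jump rate $1$, in which jumps over the edge $(i,i+1)$ are suppressed unless the particles of $\underline\xi(t)$ with labels $i$ and $i+1$ are nearest neighbours. ''Reversible stationary distribution'' means: $\underline\pi$ is a probability distribution on $Z_+^d$ satisfying detailed balance $\underline\pi(\underline x)r_{\underline\xi}(\underline x,\underline y)=\underline\pi(\underline y)r_{\underline\xi}(\underline y,\underline x)$ for all $\underline x,\underline y\in Z_+^d$ and all $\underline\xi\in\Omega$, and if $\underline x(0)\sim\underline\pi$ independently of the background process $\{\underline\xi(t)\}_{t\ge0}$, then $\underline x(t)\sim\underline\pi$ for all $t\ge0$. *)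

(* Defs.v *)
From mathcomp Require Import all_boot all_order all_algebra.
From mathcomp Require Import finmap.
From mathcomp Require Import all_classical all_reals all_analysis.
Import Order.TTheory GRing.Theory Num.Theory.
Import numFieldNormedType.Exports.

Set Implicit Arguments.
Unset Strict Implicit.
Unset Printing Implicit Defensive.

Local Open Scope classical_set_scope.
Local Open Scope ring_scope.

Section JumpProcesses.
Context {R : realType} {S : choiceType}.

(* [rate u x y] is the rate, at time [u], of the jump from [x] to [y]. *)
Variable rate : R -> S -> S -> R.

Definition exit_rate (u : R) (x : S) : \bar R :=
  (\esum_(y in [set: S]) (rate u x y)%:E)%E.

(* Probability of staying at [x] throughout [s, t]. *)
Definition stay_prob (s t : R) (x : S) : \bar R :=
  expeR (- \int[lebesgue_measure]_(u in `[s, t]) exit_rate u x)%E.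

(* Probability, starting at [x] at time [s], of making exactly [n] jumps in
   ]s, t] and of being at [y] at time [t]; the case [n.+1] integrates over the
   time [u] of the last jump and sums over the state [z] it leaves. *)
Fixpoint njump_prob (n : nat) (s t : R) (x y : S) : \bar R :=
  match n with
  | 0%N => if x == y then stay_prob s t x else 0%E
  | m.+1 => (\int[lebesgue_measure]_(u in `[s, t])
      ((\esum_(z in [set: S]) (njump_prob m s u x z * (rate u z y)%:E))
       * stay_prob u t y))%E
  end.

Definition trans_prob (s t : R) (x y : S) : \bar R :=
  (\sum_(0 <= n <oo) njump_prob n s t x y)%E.

(* Finitely many jumps in bounded time intervals, right-continuous. *)
Definition jump_path (f : R -> S) : Prop :=
  forall t, 0 <= t ->
    (\forall u \near t^'+, f u = f t) /\
    (0 < t -> exists z, \forall u \near t^'-, f u = z).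

End JumpProcesses.

Section Processes.
Context {R : realType} {d : measure_display} {T : measurableType d}.

(* The state spaces below are countable, so these events generate the
   sigma-algebra of the process restricted to the times in [D]. *)
Definition events_of {S : Type} (X : R -> T -> S) (D : set R) : set (set T) :=
  [set A | exists u y, D u /\ A = [set w | X u w = y]].

(* Conditionally on the sigma-algebra generated by [G], [X] is a (time
   inhomogeneous, non-explosive) Markov jump process on [S] whose rates
   [rate w] may depend on the outcome [w]: the conditional probability of
   X t = y given <<s G >> and (X u) for u <= s is [trans_prob] from [X s]. *)
Definition jump_process_given {S : choiceType} (P : probability T R)
    (G : set (set T)) (rate : T -> R -> S -> S -> R) (X : R -> T -> S) : Prop :=
  [/\ forall t y, 0 <= t -> measurable [set w | X t w = y],
      forall w, jump_path (fun t => X t w) &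
      forall (s t : R) (y : S) (A : set T), 0 <= s -> s <= t ->
        <<s G `|` events_of X [set u | 0 <= u <= s] >> A ->
        P (A `&` [set w | X t w = y]) =
        (\int[P]_(w in A) trans_prob (rate w) s t (X s w) y)%E].

Definition has_law {S : Type} (P : probability T R) (X : T -> S) (p : S -> R) :
    Prop :=
  forall y, P [set w | X w = y] = (p y)%:E.

(* [X0] (with countably many values) is independent of (Y t) for t >= 0. *)
Definition indep_of_process {S S' : Type} (P : probability T R) (X0 : T -> S)
    (Y : R -> T -> S') : Prop :=
  forall y (A : set T), <<s events_of Y [set u | 0 <= u] >> A ->
    P ([set w | X0 w = y] `&` A) = (P [set w | X0 w = y] * P A)%E.

End Processes.

Definition Omega : set (int -> bool) :=
  [set z | finite_set [set i : int | (i <= 0) && z i] /\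
           finite_set [set i : int | (1 <= i) && ~~ z i]].

Definition swap_sites (z : int -> bool) (i : int) : int -> bool :=
  fun k => if k == i then z (i + 1) else if k == i + 1 then z i else z k.

Definition asep_rate {R : realType} (q : R) (xi eta : Omega) : R :=
  if `[< exists i : int, [/\ val xi i, ~~ val xi (i + 1) &
                             val eta = swap_sites (val xi) i] >] then 1
  else if `[< exists i : int, [/\ ~~ val xi i, val xi (i + 1) &
                                  val eta = swap_sites (val xi) i] >] then q
  else 0.

(* Label of a particle at [a]; the set counted is finite for [xi] in [Omega]. *)
Definition label (xi : Omega) (a : int) : nat :=
  #|` fset_set [set b : int | (b < a) && val xi b] |.

Definition labels_adjacent (xi : Omega) (m n : nat) : Prop :=
  exists a b : int, [/\ val xi a, val xi b, label xi a = m, label xi b = n &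
                        `|a - b| = 1].

(* The nonnegative integers 0 <= x_1 < ... < x_d are stored as naturals; the
   coordinate x_(j+1) is [tnth (val x) j]. *)
Definition Zplus (d : nat) : Type := {x : d.-tuple nat | sorted ltn x}.

Definition set_coord {d : nat} (x : d.-tuple nat) (j : 'I_d) (n : nat) :
    d.-tuple nat :=
  [tuple if k == j then n else tnth x k | k < d].

Definition label_rate {R : realType} (q : R) {d : nat} (xi : Omega)
    (x y : Zplus d) : R :=
  \sum_(j < d)
    let xj := tnth (val x) j in
    ((if [&& xj.+1 \notin val x, val y == set_coord (val x) j xj.+1 &
             `[< labels_adjacent xi xj xj.+1 >]] then q else 0)
   + (if [&& (0 < xj)%N, xj.-1 \notin val x,
             val y == set_coord (val x) j xj.-1 &
             `[< labels_adjacent xi xj xj.-1 >]] then 1 else 0)).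

Definition is_asep {R : realType} {d' : measure_display} {T : measurableType d'}
    (P : probability T R) (q : R) (xi : R -> T -> Omega) : Prop :=
  jump_process_given P set0 (fun _ _ => asep_rate q) xi.

Definition is_label_process {R : realType} {d' : measure_display}
    {T : measurableType d'} (P : probability T R) (q : R) {d : nat}
    (xi : R -> T -> Omega) (x : R -> T -> Zplus d) : Prop :=
  jump_process_given P (events_of xi [set u | 0 <= u])
    (fun w u => label_rate q (xi u w)) x.

Definition reversible_stationary {R : realType} (q : R) {d : nat}
    (p : Zplus d -> R) : Prop :=
  [/\ (forall x, 0 <= p x) /\
      (\esum_(x in [set: Zplus d]) (p x)%:E = 1)%E,
      forall (xi : Omega) (x y : Zplus d),
        p x * label_rate q xi x y = p y * label_rate q xi y x &
      forall (d' : measure_display) (T : measurableType d')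
        (P : probability T R) (xi : R -> T -> Omega) (x : R -> T -> Zplus d),
        is_asep P q xi -> is_label_process P q xi x ->
        indep_of_process P (x 0) xi -> has_law P (x 0) p ->
        forall t, 0 <= t -> has_law P (x t) p].

(* Integer exponent; the division by 2 is exact. *)
Definition label_pi {R : realType} (q : R) (d : nat) (x : Zplus d) : R :=
  (\prod_(1 <= i < d.+1) (1 - q ^+ i)) *
  q ^ ((\sum_(i < d) tnth (val x) i)%N%:Z - ((d * (d - 1)) %/ 2)%N%:Z).

(* Main.v *)
Require Import Defs.
From mathcomp Require Import all_boot all_order all_algebra.
From mathcomp Require Import finmap.
From mathcomp Require Import all_classical all_reals all_analysis.
From mathcomp Require Import measurable_realfun.
From mathcomp Require Import ring lra zify.
Import Order.TTheory GRing.Theory Num.Theory.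
Import numFieldNormedType.Exports.

Set Implicit Arguments.
Unset Strict Implicit.
Unset Printing Implicit Defensive.

(* Conditionally on the background, the label process is a jump process with
   time-dependent rates in detailed balance with pi at every time. Hence
   f_N(t, y), the pi-average over the starting point of the probability of
   being at y at time t after fewer than N jumps, satisfies f_N <= pi: decompose
   at the last jump, bound the flow into y by pi(y) times the exit rate of y,
   and use that staying put or leaving has total probability at most 1. As the
   starting point is independent of the background, averaging over the
   background gives P(x(t) = y) <= pi(y) for all y. Both sides sum to 1, so they
   are equal. *)

Local Open Scope classical_set_scope.
Local Open Scope ring_scope.

(** * Survival probabilities for a measurable hazard rate *)
Section Survival.
Context {R : realType}.
Local Open Scope ereal_scope.
Implicit Types (a b c s t u : R) (f : R -> \bar R).

Lemma measurable_expeR : measurable_fun [set: \bar R] (@expeR R).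
Proof.
apply: (eq_measurable_fun (fun x : \bar R =>
  if x == +oo then +oo else if x == -oo then 0 else (expR (fine x))%:E)).
  by move=> [r| |] _ //=.
apply: measurable_fun_ifT; [exact: measurable_fun_eqe|exact: measurable_cst|].
apply: measurable_fun_ifT; [exact: measurable_fun_eqe|exact: measurable_cst|].
apply/measurable_EFinP; apply: measurableT_comp; first exact: measurable_expR.
exact: fine_measurable.
Qed.

(** The moving endpoints go into the integrand as an indicator, so that Tonelli measurability over
    the whole line applies. *)
Lemma measurable_integral_itv d (T : measurableType d) (f : T * R -> \bar R)
    (a b : T -> R) :
  measurable_fun [set: T * R] f -> (forall p, 0 <= f p) ->
  measurable_fun [set: T] a -> measurable_fun [set: T] b ->
  measurable_fun [set: T]
    (fun p => \int[lebesgue_measure]_(u in `[a p, b p]) f (p, u)).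
Proof.
move=> mf f0 ma mb.
pose g (p : T * R) :=
  if ((a p.1 <= p.2) && (p.2 <= b p.1))%R then f p else 0.
have mg : measurable_fun [set: T * R] g.
  apply: measurable_fun_ifT => //.
  apply: measurable_and; apply: measurable_fun_ler => //.
  - exact: measurableT_comp.
  - exact: measurableT_comp.
have g0 p : 0 <= g p by rewrite /g; case: ifP.
apply: (eq_measurable_fun (fubini_F (@lebesgue_measure R) g)); last first.
  exact: measurable_fun_fubini_tonelli_F.
move=> p _; rewrite /fubini_F [RHS]integral_mkcond; apply: eq_integral => u _.
by rewrite /g patchE mem_setE in_itv.
Qed.

Lemma ge0_integral_itv_cat f a b c : measurable_fun [set: R] f ->
  (forall u, 0 <= f u) -> (a <= b <= c)%R ->
  \int[lebesgue_measure]_(u in `[a, c]) f u =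
  \int[lebesgue_measure]_(u in `[a, b]) f u +
  \int[lebesgue_measure]_(u in `[b, c]) f u.
Proof.
move=> mf f0 /andP[ab bc].
have mfD D : measurable_fun D f by apply: measurable_funTS.
rewrite (@itv_bndbnd_setU _ _ (BLeft a) (BLeft b) (BRight c)) ?bnd_simp//.
rewrite ge0_integral_setU//; last first.
  rewrite disj_set2E; apply/eqP/seteqP; split => // u /=; rewrite !in_itv/=.
  by move=> [/andP[_ ub] /andP[bu _]]; move: (lt_le_trans ub bu); rewrite ltxx.
  exact: mfD.
by rewrite integral_itv_bndo_bndc//; exact: mfD.
Qed.

(** From [1 + x <= expR x] and [(1 + x) * (1 - x + x ^+ 2) = 1 + x ^+ 3 >= 1]. The error is of
    second order, as the bisection below requires. *)
Lemma expRN_le_quadratic (x : R) : (0 <= x)%R -> (expR (- x) <= 1 - x + x ^+ 2)%R.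
Proof.
move=> x0; rewrite expRN.
have h : (0 < 1 + x)%R by lra.
apply: (@le_trans _ _ (1 + x)^-1%R).
  by rewrite lef_pV2 ?posrE ?expR_gt0//; exact: expR_ge1Dx.
rewrite -[leLHS]mul1r ler_pdivrMr//.
have : (0 <= x ^+ 3)%R by exact: exprn_ge0.
nra.
Qed.

(* With [e u := exp (- \int_[u, t] l)] the left-hand side is [e s] plus the
   integral over [s, t] of the derivative of [e]. As [l] is only measurable,
   the additive quantity [\int_[a, b] l e - (e b - e a)] is bounded by
   [K * (b - a) ^+ 2] on every subinterval; bisecting divides [K] by 2. *)
Lemma survival_flux_le1 (l : R -> \bar R) (C s t : R) :
  measurable_fun [set: R] l -> (forall u, 0 <= l u) ->
  (forall u, l u <= C%:E) -> (s <= t)%R ->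
  expeR (- \int[lebesgue_measure]_(u in `[s, t]) l u) +
  \int[lebesgue_measure]_(u in `[s, t])
    (l u * expeR (- \int[lebesgue_measure]_(v in `[u, t]) l v)) <= 1.
Proof.
move=> ml l0 lC st.
have C0 : (0 <= C)%R by rewrite -lee_fin (le_trans (l0 s)).
pose L a b := \int[lebesgue_measure]_(u in `[a, b]) l u.
pose e a := expeR (- L a t).
have mlD D : measurable_fun D l by apply: measurable_funTS.
have L0 a b : 0 <= L a b by apply: integral_ge0.
have LC a b : (a <= b)%R -> L a b <= (C * (b - a))%:E.
  move=> ab; apply: (@le_trans _ _ (\int[lebesgue_measure]_(u in `[a, b]) C%:E)).
    apply: ge0_le_integral => //=; exact: mlD.
  rewrite integral_cst//= lebesgue_measure_itv/= lte_fin.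
  case: ltP => ab'; first by rewrite EFinM.
  by rewrite mule0 lee_fin mulr_ge0// subr_ge0.
have Lfin a b : (a <= b)%R -> L a b \is a fin_num.
  by move=> ab; rewrite ge0_fin_numE//; apply: le_lt_trans (LC _ _ ab) (ltry _).
have Lcat a b c : (a <= b <= c)%R -> L a c = L a b + L b c.
  by move=> abc; exact: ge0_integral_itv_cat.
have me : measurable_fun [set: R] e.
  apply: (measurableT_comp measurable_expeR); apply: measurableT_comp => //.
  by apply: (measurable_integral_itv (f := fun p => l p.2)) => //;
    exact: measurableT_comp.
have e0 a : 0 <= e a by exact: expeR_ge0.
have mle : measurable_fun [set: R] (fun u => l u * e u).
  exact: emeasurable_funM.
have le0 u : 0 <= l u * e u by rewrite mule_ge0.
pose G a b := \int[lebesgue_measure]_(u in `[a, b]) (l u * e u).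
have ele a b : (a <= b)%R -> (b <= t)%R -> e a <= e b.
  move=> ab bt; rewrite /e lee_expeR leeN2 (Lcat a b t) ?ab//.
  by rewrite leeDr.
have et : e t = 1 by rewrite /e /L set_itv1 integral_set1 oppe0 expeR0.
(* With [x = L a b] and [y = e b <= 1]: monotonicity of [e] gives [G a b <= x * y], and
   [e a = expR (- x) * y], so the sum is at most [y + x ^+ 2]. *)
have base a b : (a <= b)%R -> (b <= t)%R ->
    G a b + e a <= e b + ((C * (b - a)) ^+ 2)%:E.
  move=> ab bt.
  have GL : G a b <= L a b * e b.
    have -> : L a b * e b =
        \int[lebesgue_measure]_(u in `[a, b]) (l u * e b).
      by apply/esym/ge0_integralZr => //; exact: mlD.
    apply: ge0_le_integral => //=.
    - exact: measurable_funTS.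
    - by apply: emeasurable_funM => //; exact: mlD.
    - move=> u; rewrite in_itv/= => /andP[_ ub].
      by rewrite lee_wpmul2l// ele.
  apply: le_trans (leeD GL (lexx _)) _.
  have -> : e a = expeR (- L a b) * e b.
    by rewrite /e (Lcat a b t) ?ab// fin_num_oppeD ?Lfin// expeRD.
  have := LC _ _ ab; have := L0 a b.
  have /fineK <- := Lfin _ _ ab; set x := fine _ => x0 xC.
  have := ele _ _ bt (lexx t); have := e0 b; rewrite et.
  have /fineK <- : e b \is a fin_num.
    rewrite ge0_fin_numE//; apply: le_lt_trans (ele _ _ bt (lexx t)) _.
    by rewrite et ltry.
  set y := fine _; rewrite /= !lee_fin in x0 xC * => y0 y1.
  have := expRN_le_quadratic x0; set z := expR _ => zx.
  have : (x ^+ 2 <= (C * (b - a)) ^+ 2)%R by rewrite lerXn2r ?nnegrE// (le_trans x0).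
  have : (z * y <= (1 - x + x ^+ 2) * y)%R by rewrite ler_wpM2r.
  have : (x ^+ 2 * y <= x ^+ 2)%R by rewrite ler_piMr// sqr_ge0.
  lra.
have bisect n a b : (s <= a)%R -> (a <= b)%R -> (b <= t)%R ->
    G a b + e a <= e b + ((C * (b - a)) ^+ 2 / 2 ^+ n)%:E.
  elim: n a b => [|n IH] a b sa ab bt; first by rewrite expr0 divr1; exact: base.
  pose m := ((a + b) / 2)%R.
  have am : (a <= m)%R by rewrite /m; lra.
  have mb : (m <= b)%R by rewrite /m; lra.
  rewrite {1}/G (@ge0_integral_itv_cat _ a m b) ?am// -/(G a m) -/(G m b).
  have h1 := IH a m sa am (le_trans mb bt).
  have h2 := IH m b (le_trans sa am) mb bt.
  rewrite addeAC; apply: (le_trans (leeD h1 (lexx _))).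
  rewrite addeC addeA.
  apply: (le_trans (leeD h2 (lexx _))).
  rewrite -addeA leeD2l// -EFinD lee_fin.
  suff -> : ((C * (b - m)) ^+ 2 / 2 ^+ n + (C * (m - a)) ^+ 2 / 2 ^+ n =
    (C * (b - a)) ^+ 2 / 2 ^+ n.+1)%R by [].
  by rewrite /m (exprS 2%R n); field; rewrite expf_neq0.
apply/lee_addgt0Pr => eps eps0.
(* The added 1 keeps [K] positive even if [C = 0] or [s = t], so that [eps / K] can serve as a
   threshold. *)
pose K : R := ((C * (t - s)) ^+ 2 + 1)%R.
have K0 : (0 < K)%R by rewrite /K ltr_wpDl// sqr_ge0.
have Ke0 : (0 < eps / K)%R by rewrite divr_gt0.
have [n _ /(_ n (leqnn n)) hn] := near_infty_natSinv_expn_lt (PosNum Ke0).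
rewrite addeC; apply: (le_trans (bisect n s t (lexx _) st (lexx _))).
rewrite et leeD2l// lee_fin.
move: hn => /=; rewrite div1r ltr_pdivlMr// => /ltW hn.
apply: le_trans hn; rewrite mulrC ler_wpM2l ?invr_ge0 ?exprn_ge0//.
by rewrite /K lerDl.
Qed.
End Survival.

(** * Sums over countable types *)
Section CountableSums.
Context {R : realType}.
Local Open Scope ereal_scope.

(** Codes that stand for no element contribute 0. Facts on series over [nat] (measurability,
    exchange with integrals, scaling) thereby transfer to sums over [S]. *)
Lemma esum_pickle (S : countType) (a : S -> \bar R) : (forall y, 0 <= a y) ->
  \esum_(y in [set: S]) a y =
  \sum_(0 <= n <oo) oapp a 0 (pickle_inv n).
Proof.
move=> a0; rewrite nneseries_esumT => [|n]; last by case: pickle_inv.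
rewrite -(eq_esum (a := fun y => oapp a 0 (pickle_inv (choice.pickle y)))); last first.
  by move=> y _; rewrite pickleK_inv.
rewrite -(@esum_image _ _ _ _ (@choice.pickle S)
  (fun n => oapp a 0 (pickle_inv n))); last first.
  by move=> x y _ _; exact: (pcan_inj (@pickleK_inv S)).
rewrite [LHS]esum_mkcond; apply: eq_esum => n _.
case: ifPn => //; rewrite notin_setE /=.
have := @pickle_invK S n; case: pickle_inv => //= y yn nex.
by exfalso; apply: nex; exists y.
Qed.

Lemma measurable_fun_esum d (T : measurableType d) (S : countType)
    (h : S -> T -> \bar R) :
  (forall y, measurable_fun [set: T] (h y)) -> (forall y x, 0 <= h y x) ->
  measurable_fun [set: T] (fun x => \esum_(y in [set: S]) h y x).
Proof.
move=> mh h0.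
under eq_fun do rewrite esum_pickle//.
apply: ge0_emeasurable_sum => [n x _ _|n _]; case: pickle_inv => //= y.
Qed.

Lemma ge0_integral_esum d (T : measurableType d) (mu : {measure set T -> \bar R})
    (D : set T) (S : countType) (h : S -> T -> \bar R) :
  measurable D ->
  (forall y, measurable_fun D (h y)) -> (forall y x, 0 <= h y x) ->
  \int[mu]_(x in D) (\esum_(y in [set: S]) h y x) =
  \esum_(y in [set: S]) \int[mu]_(x in D) h y x.
Proof.
move=> mD mh h0; rewrite esum_pickle; last by move=> y; exact: integral_ge0.
under eq_integral do rewrite esum_pickle//.
rewrite integral_nneseries//.
- apply: eq_eseriesr => n _; case: pickle_inv => //=.
  by rewrite integral0.
- by move=> n; case: pickle_inv => //=; exact: measurable_cst.
- by move=> n x _; case: pickle_inv => //=.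
Qed.

Lemma ge0_esumZl (S : countType) (a : S -> \bar R) (k : R) :
  (forall y, 0 <= a y) -> (0 <= k)%R ->
  \esum_(y in [set: S]) (k%:E * a y) = k%:E * \esum_(y in [set: S]) a y.
Proof.
move=> a0 k0; rewrite !esum_pickle//; last first.
  by move=> y; rewrite mule_ge0// lee_fin.
rewrite -nneseriesZl => [|n _]; last by case: pickle_inv.
by apply: eq_eseriesr => n _; case: pickle_inv => //=; rewrite mule0.
Qed.

Lemma exchange_esum (S S' : choiceType) (a : S -> S' -> \bar R) :
  (forall x y, 0 <= a x y) ->
  \esum_(x in [set: S]) (\esum_(y in [set: S']) a x y) =
  \esum_(y in [set: S']) \esum_(x in [set: S]) a x y.
Proof.
move=> a0; rewrite !esum_esum//.
apply: (@reindex_esum _ _ _ ([set: S'] `*`` (fun=> [set: S])) _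
  (fun p => (p.2, p.1)) (fun p => a p.1 p.2)).
split=> [p|[x y] [x' y'] _ _ /= [-> ->]|[x y] _] //.
by exists (y, x).
Qed.
End CountableSums.

(** * Subinvariance of reversible weights *)
Section JumpKernels.
Context {R : realType}.
Local Open Scope ereal_scope.

Lemma exit_rate_ge0 (S : choiceType) (r : R -> S -> S -> R) u x :
  (forall u x y, (0 <= r u x y)%R) -> 0 <= exit_rate r u x.
Proof. by move=> r0; apply: esum_ge0 => y _; rewrite lee_fin. Qed.

Lemma stay_prob_le1 (S : choiceType) (r : R -> S -> S -> R) s t x :
  (forall u x y, (0 <= r u x y)%R) -> stay_prob r s t x <= 1.
Proof.
move=> r0; rewrite -[leRHS]expeR0 lee_expeR leeNl oppe0.
by apply: integral_ge0 => u _; exact: exit_rate_ge0.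
Qed.

Lemma njump_prob_ge0 (S : choiceType) (r : R -> S -> S -> R) n s t x y :
  (forall u x y, (0 <= r u x y)%R) -> 0 <= njump_prob r n s t x y.
Proof.
move=> r0; elim: n t y => [|n IH] t y /=; first by case: eqP => // _; exact: expeR_ge0.
apply: integral_ge0 => u _; rewrite mule_ge0 ?expeR_ge0//.
by apply: esum_ge0 => z _; rewrite mule_ge0 ?lee_fin.
Qed.

(** Every integral in the recursion runs over times from [s] on. This later permits replacing the
    rates at negative times. *)
Lemma eq_njump_prob (S : choiceType) (r r' : R -> S -> S -> R) n s t x y :
  (forall u, (s <= u)%R -> r u = r' u) ->
  njump_prob r n s t x y = njump_prob r' n s t x y.
Proof.
move=> rr'.
have stayE a b z : (s <= a)%R -> stay_prob r a b z = stay_prob r' a b z.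
  move=> sa; rewrite /stay_prob; congr (expeR (- _)).
  apply: eq_integral => u; rewrite inE/= in_itv/= => /andP[au _].
  by rewrite /exit_rate rr'// (le_trans sa).
elim: n t y => [|n IH] t y /=; first by case: eqP => // _; exact: stayE.
apply: eq_integral => u; rewrite inE/= in_itv/= => /andP[su _].
rewrite stayE//; congr (_ * _).
by apply: eq_esum => z _; rewrite IH rr'.
Qed.

(** * Joint measurability of the jump probabilities *)

Section Measurability.
Context {d : measure_display} {T : measurableType d} {S : countType}.
Variable r : T -> R -> S -> S -> R.
Hypothesis r0 : forall w u x y, (0 <= r w u x y)%R.
Hypothesis mr : forall x y, measurable_fun [set: T * R] (fun p => r p.1 p.2 x y).

Lemma measurable_exit_rate x :
  measurable_fun [set: T * R] (fun p => exit_rate (r p.1) p.2 x).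
Proof.
apply: measurable_fun_esum => y; last by move=> p; rewrite lee_fin.
exact/measurable_EFinP.
Qed.

(** Joint in the outcome and both endpoints, since the last-jump recursion varies the start [u] as
    well as the end [t]. *)
Lemma measurable_stay_prob x : measurable_fun [set: (T * R) * R]
  (fun p => stay_prob (r p.1.1) p.1.2 p.2 x).
Proof.
apply: (measurableT_comp measurable_expeR).
apply: measurableT_comp => //.
apply: (measurable_integral_itv
  (f := fun q : ((T * R) * R) * R => exit_rate (r q.1.1.1) q.2 x)).
- apply: (measurableT_comp (measurable_exit_rate x)
    (g := fun q : ((T * R) * R) * R => (q.1.1.1, q.2))).
  apply: measurable_fun_pair => //.
  by do 2![apply: measurableT_comp => //].
- by move=> p; exact: exit_rate_ge0.
- exact: measurableT_comp.
- exact: measurable_snd.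
Qed.

(** Induction with the final state general: the recursion passes to the state and the time just
    before the last jump. *)
Lemma measurable_njump_prob n s x y :
  measurable_fun [set: T * R] (fun p => njump_prob (r p.1) n s p.2 x y).
Proof.
elim: n y => [|n IH] y /=.
  case: eqP => _ //.
  apply: (measurableT_comp (measurable_stay_prob x)
    (g := fun q : T * R => ((q.1, s), q.2))).
  by apply: measurable_fun_pair => //; exact: measurable_fun_pair.
apply: (measurable_integral_itv (f := fun q : (T * R) * R =>
  (\esum_(z in [set: S]) (njump_prob (r q.1.1) n s q.2 x z * (r q.1.1 q.2 z y)%:E))
  * stay_prob (r q.1.1) q.2 q.1.2 y)) => //.
- have mg : measurable_fun [set: (T * R) * R] (fun q => (q.1.1, q.2)).
    by apply: measurable_fun_pair => //; exact: measurableT_comp.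
  apply: emeasurable_funM.
    apply: measurable_fun_esum => [z|z p]; last first.
      by rewrite mule_ge0 ?lee_fin// njump_prob_ge0.
    apply: emeasurable_funM; first exact: (measurableT_comp (IH z) mg).
    by apply/measurable_EFinP; exact: (measurableT_comp (mr z y) mg).
  apply: (measurableT_comp (measurable_stay_prob y)
    (g := fun q : (T * R) * R => ((q.1.1, q.2), q.1.2))).
  by apply: measurable_fun_pair => //; exact: measurableT_comp.
- move=> p; rewrite mule_ge0 ?expeR_ge0//.
  by apply: esum_ge0 => z _; rewrite mule_ge0 ?lee_fin// njump_prob_ge0.
Qed.

Lemma measurable_trans_prob s t x y :
  measurable_fun [set: T] (fun w => trans_prob (r w) s t x y).
Proof.
apply: ge0_emeasurable_sum => [n w _ _|n _]; first exact: njump_prob_ge0.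
exact: (measurableT_comp (measurable_njump_prob n s x y)
    (g := fun w => (w, t)) (measurable_pair2 _)).
Qed.
End Measurability.

(** * Flows under detailed balance *)

Section DetailedBalance.
Context {S : countType}.
Variables (r : R -> S -> S -> R) (p : S -> R) (C : S -> R).
Hypothesis r0 : forall u x y, (0 <= r u x y)%R.
Hypothesis mr : forall x y, measurable_fun [set: R] (fun u => r u x y).
Hypothesis exit_le : forall u x, exit_rate r u x <= (C x)%:E.
Hypothesis p0 : forall x, (0 <= p x)%R.
Hypothesis balance : forall u x y, (p x * r u x y = p y * r u y x)%R.

(** Rates without randomness are treated as rates over the one-point space [unit], to reuse the
    joint measurability results. *)
Let mr' x y : measurable_fun [set: unit * R] (fun q => r q.2 x y).
Proof. exact: (measurableT_comp (mr x y)). Qed.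

Let mexit x : measurable_fun [set: R] (fun u => exit_rate r u x).
Proof.
exact: (measurableT_comp (measurable_exit_rate (r := fun=> r) (fun=> r0) mr' x)
  (g := fun u => (tt, u)) (measurable_pair1 _)).
Qed.

Let mnjump n s x y : measurable_fun [set: R] (fun u => njump_prob r n s u x y).
Proof.
exact: (measurableT_comp (measurable_njump_prob (r := fun=> r) (fun=> r0) mr' n s x y)
  (g := fun u => (tt, u)) (measurable_pair1 _)).
Qed.

Let mstay t x : measurable_fun [set: R] (fun u => stay_prob r u t x).
Proof.
exact: (measurableT_comp (measurable_stay_prob (r := fun=> r) (fun=> r0) mr' x)
  (g := fun u => ((tt, u), t))
  (measurable_fun_pair (measurable_pair1 _) (measurable_cst _))).
Qed.

(** Detailed balance turns each term of the flow into [y] into the reverse flow out of [y]; these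
    sum to the exit rate. *)
Lemma flow_in_eq u y :
  \esum_(z in [set: S]) ((p z)%:E * (r u z y)%:E) = (p y)%:E * exit_rate r u y.
Proof.
rewrite -ge0_esumZl//; last by move=> z; rewrite lee_fin.
by apply: eq_esum => z _; rewrite -!EFinM balance.
Qed.

(* At most [N.-1] jumps: the last-jump decomposition of the definition turns
   [flow_in_eq] into an inequality that propagates from [N] to [N.+1]. *)
Lemma partial_subinvariance N s t y : (s <= t)%R ->
  \esum_(x in [set: S]) ((p x)%:E * \sum_(0 <= n < N) njump_prob r n s t x y)
  <= (p y)%:E.
Proof.
elim: N t y => [|N IH] t y st.
  by rewrite esum1 ?lee_fin// => x _; rewrite big_geq// mule0.
pose F u x z := \sum_(0 <= n < N) njump_prob r n s u x z.
have F0 u x z : 0 <= F u x z by apply: sume_ge0 => n _; exact: njump_prob_ge0.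
have mF x z : measurable_fun [set: R] (fun u => F u x z).
  by apply: emeasurable_sum => n; exact: mnjump.
have stay0 u : 0 <= stay_prob r u t y by exact: expeR_ge0.
have minflow (f : S -> R -> \bar R) :
    (forall z, measurable_fun [set: R] (f z)) -> (forall z u, 0 <= f z u) ->
    measurable_fun [set: R]
      (fun u => (\esum_(z in [set: S]) (f z u * (r u z y)%:E)) * stay_prob r u t y).
  move=> mf f0; apply: emeasurable_funM; last exact: mstay.
  apply: measurable_fun_esum => [z|z u]; last by rewrite mule_ge0 ?lee_fin.
  by apply: emeasurable_funM => //; exact/measurable_EFinP.
(* At most [N] jumps: either none, or a last jump at time [u] preceded by fewer than [N] jumps,
   which is where [F] enters. *)
have recF x : \sum_(0 <= n < N.+1) njump_prob r n s t x y =
    (if x == y then stay_prob r s t x else 0) +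
    \int[lebesgue_measure]_(u in `[s, t])
      ((\esum_(z in [set: S]) (F u x z * (r u z y)%:E)) * stay_prob r u t y).
  rewrite big_nat_recl//=; congr (_ + _).
  rewrite -ge0_integral_sum//.
  - apply: eq_integral => u _; rewrite -ge0_sume_distrl; last first.
      by move=> n _; apply: esum_ge0 => z _; rewrite mule_ge0 ?lee_fin ?njump_prob_ge0.
    congr (_ * _); rewrite -esum_sum; last first.
      by move=> z n _ _; rewrite mule_ge0 ?lee_fin ?njump_prob_ge0.
    apply: eq_esum => z _; rewrite ge0_sume_distrl// => n _.
    exact: njump_prob_ge0.
  - move=> n; apply: measurable_funTS.
    by apply: (minflow (fun z u => njump_prob r n s u x z)) => // z u;
      exact: njump_prob_ge0.
  - move=> n u _; rewrite mule_ge0//; apply: esum_ge0 => z _.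
    by rewrite mule_ge0 ?lee_fin ?njump_prob_ge0.
pose H x u :=
  (\esum_(z in [set: S]) (F u x z * (r u z y)%:E)) * stay_prob r u t y.
have H0 x u : 0 <= H x u.
  rewrite mule_ge0//; apply: esum_ge0 => z _; by rewrite mule_ge0 ?lee_fin.
have mH x : measurable_fun [set: R] (H x) by exact: (minflow (fun z u => F u x z)).
have mpH x : measurable_fun [set: R] (fun u => (p x)%:E * H x u).
  by apply: emeasurable_funM => //; exact: mH.
(* The no-jump term survives only at [x = y]; membership in [[set y]] lets its sum over [x]
   collapse. *)
rewrite (eq_esum (b := fun x =>
  (if x \in [set y] then (p x)%:E * stay_prob r s t x else 0) +
  \int[lebesgue_measure]_(u in `[s, t]) ((p x)%:E * H x u))); last first.
  move=> x _; rewrite recF ge0_muleDr; last 2 first.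
  - by case: ifP => // _; exact: expeR_ge0.
  - by apply: integral_ge0 => u _; exact: H0.
  rewrite ge0_integralZl ?lee_fin//; last by apply: measurable_funTS; exact: mH.
  congr (_ + _); case: eqP => [->|xy]; first by rewrite mem_set.
  by rewrite memNset// mule0.
rewrite esumD; last 2 first.
- by move=> x _; case: ifP => // _; rewrite mule_ge0 ?lee_fin ?expeR_ge0.
- by move=> x _; apply: integral_ge0 => u _; rewrite mule_ge0 ?lee_fin.
rewrite -esum_mkcond esum_set1 ?mule_ge0 ?lee_fin ?expeR_ge0//.
rewrite -ge0_integral_esum//; last 2 first.
- by move=> x; apply: measurable_funTS; exact: mpH.
- by move=> x u; rewrite mule_ge0 ?lee_fin.
pose E u := exit_rate r u y * stay_prob r u t y.
have E0 u : 0 <= E u by rewrite mule_ge0// exit_rate_ge0.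
have mE : measurable_fun [set: R] E.
  by apply: emeasurable_funM; [exact: mexit|exact: mstay].
(* Summing over the starting point first, the induction hypothesis bounds the mass at each [z] at
   time [u] by [p z]; [flow_in_eq] then evaluates the flow into [y]. *)
have HE u : (s <= u)%R -> \esum_(x in [set: S]) ((p x)%:E * H x u) <= (p y)%:E * E u.
  move=> su; have : 0 <= stay_prob r u t y by [].
  have /fineK skE : stay_prob r u t y \is a fin_num.
    by rewrite ge0_fin_numE// (le_lt_trans (stay_prob_le1 _ _ _ _))// ltry.
  rewrite /H /E -skE; set k := fine _; rewrite lee_fin => k0.
  under eq_fun do rewrite muleA muleC.
  rewrite ge0_esumZl//; last first.
    by move=> x; rewrite mule_ge0 ?lee_fin// esum_ge0// => z _; rewrite mule_ge0 ?lee_fin.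
  rewrite muleA [leRHS]muleC lee_wpmul2l ?lee_fin//.
  rewrite (eq_esum (b := fun x =>
    \esum_(z in [set: S]) ((p x)%:E * (F u x z * (r u z y)%:E)))); last first.
    by move=> x _; rewrite ge0_esumZl// => z; rewrite mule_ge0 ?lee_fin.
  rewrite exchange_esum; last by move=> x z; rewrite !mule_ge0 ?lee_fin.
  rewrite -flow_in_eq; apply: le_esum => z _.
  under eq_fun do rewrite muleA muleC.
  rewrite ge0_esumZl//; last by move=> x; rewrite mule_ge0 ?lee_fin.
  by rewrite muleC lee_wpmul2r ?lee_fin// IH.
apply: (@le_trans _ _ ((p y)%:E * (stay_prob r s t y +
    \int[lebesgue_measure]_(u in `[s, t]) E u))).
  rewrite ge0_muleDr; last 2 first.
  - exact: expeR_ge0.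
  - by apply: integral_ge0 => u _.
  rewrite leeD2l// -ge0_integralZl ?lee_fin//; last by apply: measurable_funTS; exact: mE.
  apply: ge0_le_integral => //.
  - by move=> u _; apply: esum_ge0 => x _; rewrite mule_ge0 ?lee_fin.
  - apply: measurable_funTS; apply: measurable_fun_esum => [x|x u]; first exact: mpH.
    by rewrite mule_ge0 ?lee_fin.
  - by apply: measurable_funTS; apply: emeasurable_funM => //; exact: mE.
  - by move=> u; rewrite /= in_itv/= => /andP[su _]; exact: HE.
rewrite -[leRHS]mule1 lee_wpmul2l ?lee_fin//.
(* Read backwards from [t], the exit rate of [y] is a hazard rate: the two terms are the
   probabilities of no event and of a first event in [[s, t]]. *)
apply: (survival_flux_le1 (C := C y)) => // u.
exact: exit_rate_ge0.
Qed.

(** The sums over the starting point and the number of jumps are exchanged; the bound on partial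
    sums then passes to the limit. *)
Lemma trans_prob_subinvariance s t y : (s <= t)%R ->
  \esum_(x in [set: S]) ((p x)%:E * trans_prob r s t x y) <= (p y)%:E.
Proof.
move=> st.
have nj0 n x : 0 <= njump_prob r n s t x y by exact: njump_prob_ge0.
rewrite (eq_esum (b := fun x => \sum_(0 <= n <oo)
    ((p x)%:E * njump_prob r n s t x y))); last first.
  by move=> x _; rewrite nneseriesZl.
rewrite (eq_esum (b := fun x => \esum_(n in [set: nat])
    ((p x)%:E * njump_prob r n s t x y))); last first.
  by move=> x _; rewrite nneseries_esumT// => n; rewrite mule_ge0 ?lee_fin.
rewrite exchange_esum; last by move=> x n; rewrite mule_ge0 ?lee_fin.
rewrite -nneseries_esumT => [|n]; last first.
  by apply: esum_ge0 => x _; rewrite mule_ge0 ?lee_fin.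
apply: lime_le.
  apply: is_cvg_nneseries => n _ _.
  by apply: esum_ge0 => x _; rewrite mule_ge0 ?lee_fin.
apply: nearW => N; rewrite -esum_sum; last by move=> x n _ _; rewrite mule_ge0 ?lee_fin.
apply: le_trans (partial_subinvariance N y st).
by apply: le_esum => x _; rewrite ge0_sume_distrr.
Qed.
End DetailedBalance.
End JumpKernels.

(** * Measurable paths and independence *)
(** A preimage is a countable union of fibres of [f]. The real-valued [g] stands in for a
    sigma-algebra on [S]. *)
Lemma measurable_fun_fibers (R : realType) d (T : measurableType d)
    (S : choiceType) (f : T -> S) (g : S -> R) : countable [set: S] ->
  (forall y, measurable [set w | f w = y]) -> measurable_fun [set: T] (g \o f).
Proof.
move=> countS mf _ B mB; rewrite setTI.
rewrite (_ : _ @^-1` B = \bigcup_(y : S)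
    (if y \in g @^-1` B then [set w | f w = y] else set0)).
  by apply: countable_bigcupT_measurable => // y; case: ifP => // _; exact: mf.
apply/seteqP; split=> [w Bw|w [y _]].
  by exists (f w) => //; rewrite mem_set.
by case: ifPn => // /set_mem Bw /= ->.
Qed.

Section PathMeasurability.
Context {R : realType} {d : measure_display} {T : measurableType d} {S : choiceType}.
Hypothesis countS : countable [set: S].

(* [X] at time [u] is the limit of [X] at the grid points
   [(trunc (n.+1 * u)).+1 / n.+1], which decrease to [u] from the right. *)
Lemma measurable_jump_path (X : R -> T -> S) (g : S -> R) :
  (forall t y, 0 <= t -> measurable [set w | X t w = y]) ->
  (forall w, jump_path (X^~ w)) ->
  measurable_fun [set: T * R] (fun p => g (X (Num.max p.2 0) p.1)).
Proof.
move=> mX pX.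
pose N n (u : R) := Num.trunc (n.+1%:R * u).
pose U n u : R := (N n u).+1%:R / n.+1%:R.
(* The event is cut out by two thresholds on [u]; as [Num.trunc] sends negative numbers to 0, the
   case [k = 0] has no lower threshold. *)
have mN n k : measurable [set u | N n u = k].
  have : measurable_fun [set: R] (fun u : R =>
      ~~ (k.+1%:R <= n.+1%:R * u) && ((k == 0)%N || (k%:R <= n.+1%:R * u))).
    apply: measurable_and.
      by apply: measurable_neg; apply: measurable_fun_ler.
    by apply: measurable_or => //; apply: measurable_fun_ler.
  move=> /(_ measurableT [set true] I); rewrite setTI; congr measurable.
  apply/seteqP; split=> u /=; rewrite /N -truncn_gt_nat -leqNgt.
    move=> /andP[uk]; case: k uk => [|k] uk; first by move: uk; rewrite leqn0 => /eqP.
    by rewrite /= -truncn_gt_nat => ku; apply/eqP; rewrite eqn_leq uk ku.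
  move=> <-; rewrite leqnn /=; case E: (Num.trunc _) => [|m] //=.
  by rewrite -truncn_gt_nat E ltnSn.
apply: (measurable_fun_cvg (h := fun n p => g (X (U n p.2) p.1))) => [n|[w u] _].
  have mV y : measurable [set p : T * R | X (U n p.2) p.1 = y].
    rewrite (_ : [set p | _] = \bigcup_k
      ([set w | X (k.+1%:R / n.+1%:R) w = y] `*` [set u | N n u = k])).
      apply: bigcup_measurable => k _; apply: measurableX => //.
      by apply: mX; rewrite divr_ge0.
    apply/seteqP; split => [[w u] /= Xy|[w u] [k _ [/= Xy Nk]]].
      by exists (N n u).
    by rewrite /U Nk.
  exact: (measurable_fun_fibers (f := fun p : T * R => X (U n p.2) p.1)).
(* Paths are constant just to the right of [t], so the approximations are eventually constant once
   [t < U n u <= t + n.+1%:R^-1] is known. *)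
apply: cvg_near_cst.
set t := Num.max u 0.
have t0 : 0 <= t by rewrite le_max lexx orbT.
have [+ _] := pX w t t0; rewrite /at_right /within/= => /nbhs_ballP[e /= e0 He].
have [m _ Hm] := near_infty_natSinv_lt (PosNum e0).
have n1 n : (0 : R) < n.+1%:R by [].
have tU n : t < U n u.
  rewrite /t gt_max andbC divr_gt0//=.
  have [u0|u0] := leP 0 u; last by rewrite (lt_trans u0)// divr_gt0.
  rewrite ltr_pdivlMr// mulrC.
  by have /andP[] := truncn_itv (mulr_ge0 (ltW (n1 n)) u0).
have Ut n : U n u <= t + n.+1%:R^-1.
  rewrite /U -natr1 mulrDl div1r lerD2r ler_pdivrMr// mulrC.
  have [u0|u0] := leP 0 u.
    rewrite /t max_l//.
    by have /andP[] := truncn_itv (mulr_ge0 (ltW (n1 n)) u0).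
  rewrite (_ : N n u = 0%N) ?mulr_ge0//; apply/truncn0Pn; rewrite -ltNge.
  by rewrite (lt_trans _ ltr01)// pmulr_rlt0.
exists m => // n /Hm /= ne; congr g; apply: He => //=.
rewrite /ball/= ltr_distlC; apply/andP; split.
  by rewrite (lt_trans _ (tU n))// ltrBlDr ltrDl.
by rewrite (le_lt_trans (Ut n))// ltrD2l.
Qed.
End PathMeasurability.

(** * Integrating a function over an independent event *)

Section Independence.
Context {R : realType} {d : measure_display} {T : measurableType d}.
Local Open Scope ereal_scope.

Lemma integral_mrestr (mu : {measure set T -> \bar R}) (B : set T)
    (mB : measurable B) (f : T -> \bar R) :
  measurable_fun [set: T] f -> (forall w, 0 <= f w) ->
  \int[mrestr mu mB]_w f w = \int[mu]_(w in B) f w.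
Proof.
move=> mf f0; rewrite -(setUv B) ge0_integral_setU//; last 3 first.
- exact: measurableC.
- exact: measurable_funTS.
- by rewrite disj_set2E setICr.
rewrite [X in _ + X = _](eq_measure_integral mzero); last first.
  move=> A mA AB; rewrite /mzero /= /mrestr.
  by rewrite (_ : A `&` B = set0) ?measure0//; apply/disjoints_subset.
rewrite integral_measure_zero adde0.
by apply: eq_measure_integral => A mA AB; rewrite /= /mrestr setIidl.
Qed.

(** On the sigma-algebra generated by [G], the restriction of [P] to [B] coincides with [P] scaled
    by [P B], so both integrate [f] alike. *)
Lemma indep_integral (P : probability T R) (G : set (set T)) (B : set T)
    (f : T -> \bar R) :
  G `<=` measurable -> measurable B ->
  (forall A, <<s G >> A -> P (B `&` A) = P B * P A) ->
  measurable_fun [set: g_sigma_algebraType G] f -> (forall w, 0 <= f w) ->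
  \int[P]_(w in B) f w = P B * \int[P]_w f w.
Proof.
move=> Gm mB indep mf f0.
have sGm : <<s G >> `<=` measurable.
  by apply: smallest_sub => //; exact: sigma_algebra_measurable.
(* Pushing both measures forward along the identity leaves only the sets of [<<s G >>] to
   compare. *)
pose idG : T -> g_sigma_algebraType G := id.
have mid : measurable_fun [set: T] idG.
  by move=> _ A mA; rewrite setTI; exact: sGm.
have mfT : measurable_fun [set: T] f by exact: (measurableT_comp mf mid).
rewrite -(integral_mrestr P mB)//.
have pushE (mu : {measure set T -> \bar R}) :
    \int[mu]_w f w = \int[pushforward mu idG]_w f w.
  by rewrite (ge0_integral_pushforward mid).
rewrite !pushE.
have PBfin : P B \is a fin_num by exact: fin_num_measure.
have PB0 : (0 <= fine (P B))%R by exact: fine_ge0.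
rewrite -(fineK PBfin) -[fine (P B)]/((NngNum PB0)%:num).
rewrite -ge0_integral_mscale//.
apply: eq_measure_integral => A mA _ /=.
by rewrite /pushforward /mrestr /mscale/= preimage_id fineK// setIC indep.
Qed.
End Independence.

(** * Label rates and the product formula *)
(** Meant for exit rates: a coordinate and a direction determine the target of a jump. *)
Lemma esum_unique_le (R : realType) (S : choiceType) (a : pred S) (c : R) :
  0 <= c -> (forall y y', a y -> a y' -> y = y') ->
  (\esum_(y in [set: S]) (if a y then c else 0)%:E <= c%:E)%E.
Proof.
move=> c0 uniqa; have [[y0 ay0]|noa] := pselect (exists y, a y); last first.
  rewrite esum1 ?lee_fin// => y _; case: ifP => // ay.
  by exfalso; apply: noa; exists y.
rewrite (eq_esum (b := fun y => if y \in [set y0] then c%:E else 0%E)).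
  by rewrite -esum_mkcond esum_set1 ?lee_fin.
move=> y _; case: ifPn => ay; first by rewrite mem_set// (uniqa y y0).
by rewrite memNset// => /= yy0; rewrite yy0 ay0 in ay.
Qed.

(** A configuration is determined by two finite sets: its particles at sites [i <= 0] and its holes
    at sites [i >= 1]. *)
Lemma countable_Omega : countable [set: Omega].
Proof.
apply/countable_injP.
pose A (z : int -> bool) := [set i : int | (i <= 0) && z i].
pose B (z : int -> bool) := [set i : int | (1 <= i) && ~~ z i].
exists (fun xi : Omega => choice.pickle (fset_set (A (val xi)), fset_set (B (val xi)))).
move=> xi eta _ _ /(pcan_inj (@choice.pickleK _)) [].
have [finA finB] := set_valP xi; have [finA' finB'] := set_valP eta.
move=> /(congr1 (fun F : {fset int} => [set` F])); rewrite !fset_setK// => eqA.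
move=> /(congr1 (fun F : {fset int} => [set` F])); rewrite !fset_setK// => eqB.
apply: val_inj; apply/funext => i.
have [i0|i1] := leP i 0.
  have : A (val xi) i = A (val eta) i by rewrite eqA.
  rewrite /A /= i0 /=; case: (val xi i); case: (val eta i) => //= h.
    by have : false by rewrite -h.
  by have : false by rewrite h.
have {}i1 : 1 <= i by lia.
have : B (val xi) i = B (val eta) i by rewrite eqB.
rewrite /B /= i1 /=; case: (val xi i); case: (val eta i) => //= h.
  by have : false by rewrite h.
by have : false by rewrite -h.
Qed.

Section LabelRates.
Context {R : realType} (q : R) {d : nat}.
Implicit Types (xi : Omega) (x y : Zplus d) (j : 'I_d).

Definition label_incr xi x j y :=
  [&& (tnth (val x) j).+1 \notin val x,
      val y == set_coord (val x) j (tnth (val x) j).+1 &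
      `[< labels_adjacent xi (tnth (val x) j) (tnth (val x) j).+1 >]].

Definition label_decr xi x j y :=
  [&& (0 < tnth (val x) j)%N, (tnth (val x) j).-1 \notin val x,
      val y == set_coord (val x) j (tnth (val x) j).-1 &
      `[< labels_adjacent xi (tnth (val x) j) (tnth (val x) j).-1 >]].

Lemma label_rateE xi x y : label_rate q xi x y =
  \sum_(j < d) ((if label_incr xi x j y then q else 0) +
                (if label_decr xi x j y then 1 else 0)).
Proof. by []. Qed.

Lemma tnth_set_coord (t : d.-tuple nat) j n k :
  tnth (set_coord t j n) k = if k == j then n else tnth t k.
Proof. by rewrite tnth_mktuple. Qed.

Lemma Zplus_inj x : injective (tnth (val x)).
Proof. by apply/tuple_uniqP/(sorted_uniq ltn_trans ltnn)/(valP x). Qed.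

Lemma labels_adjacent_sym xi m n : labels_adjacent xi m n -> labels_adjacent xi n m.
Proof. by move=> [a [b [xa xb la lb ab]]]; exists b, a; split=> //; rewrite distrC. Qed.

Lemma set_coordK x j n (t : d.-tuple nat) :
  t = set_coord (val x) j n -> val x = set_coord t j (tnth (val x) j).
Proof.
move=> ->; apply: eq_from_tnth => k; rewrite !tnth_set_coord.
by case: eqP => [->|].
Qed.

Lemma set_coord_notin x y j n :
  val y = set_coord (val x) j n -> n != tnth (val x) j -> tnth (val x) j \notin val y.
Proof.
move=> yE nx; apply/negP => /tnthP[k]; rewrite yE tnth_set_coord.
case: eqP => [_ /eqP|kj /Zplus_inj /esym //]; by rewrite eq_sym (negbTE nx).
Qed.

(** Moves are reversible: the vacated value is free in the new state because coordinates are
    distinct, and adjacency of labels is symmetric. *)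
Lemma label_incr_decr xi x j y : label_incr xi x j y = label_decr xi y j x.
Proof.
apply/and3P/and4P => [[x1 /eqP yE /asboolP adj]|[y0 y1 /eqP xE /asboolP adj]].
  have yj : tnth (val y) j = (tnth (val x) j).+1 by rewrite yE tnth_set_coord eqxx.
  rewrite yj /=; split=> //.
  - by apply: (set_coord_notin yE); rewrite gtn_eqF.
  - exact/eqP/(set_coordK yE).
  - exact/asboolP/labels_adjacent_sym.
have xj : tnth (val x) j = (tnth (val y) j).-1 by rewrite xE tnth_set_coord eqxx.
have yj : tnth (val y) j = (tnth (val x) j).+1 by rewrite xj prednK.
rewrite -yj; split.
- by apply: (set_coord_notin xE); rewrite -xj yj ltn_eqF.
- exact/eqP/(set_coordK xE).
- by apply/asboolP/labels_adjacent_sym; rewrite xj.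
Qed.

Lemma label_pi_incr xi x j y : q != 0 -> label_incr xi x j y ->
  label_pi q y = label_pi q x * q.
Proof.
move=> q0 /and3P[_ /eqP yE _]; rewrite /label_pi.
have -> : (\sum_(i < d) tnth (val y) i = (\sum_(i < d) tnth (val x) i).+1)%N.
  rewrite (bigD1 j)//= [in RHS](bigD1 j)//= yE tnth_set_coord eqxx addSn.
  congr (_ + _).+1; apply: eq_bigr => k kj.
  by rewrite tnth_set_coord (negbTE kj).
rewrite -mulrA -[X in _ = _ * (_ * X)]expr1z -expfzDr//.
by congr (_ * q ^ _); lia.
Qed.

(** Balance holds coordinate by coordinate: an upward move has rate [q] and multiplies the weight by
    [q], and its reversal has rate 1. *)
Lemma label_rate_balance xi x y : q != 0 ->
  label_pi q x * label_rate q xi x y = label_pi q y * label_rate q xi y x.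
Proof.
move=> q0; rewrite !label_rateE !mulr_sumr; apply: eq_bigr => j _.
rewrite -(label_incr_decr xi y j x) -(label_incr_decr xi x j y).
rewrite !mulrDr [RHS]addrC; congr (_ + _).
  by case: ifP => [/label_pi_incr ->//|_]; rewrite ?mulr1 ?mulr0.
by case: ifP => [/label_pi_incr ->//|_]; rewrite ?mulr1 ?mulr0.
Qed.

Lemma label_rate_ge0 xi x y : 0 <= q -> 0 <= label_rate q xi x y.
Proof.
move=> q0; rewrite label_rateE; apply: sumr_ge0 => j _.
by rewrite addr_ge0//; case: ifP.
Qed.

(** Each of the [d] coordinates has at most one upward target, at rate [q], and one downward target,
    at rate 1. *)
Lemma label_exit_le (xi : R -> Omega) u x : 0 <= q ->
  (exit_rate (fun u => label_rate q (xi u)) u x <= ((q + 1) *+ d)%:E)%E.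
Proof.
move=> q0; rewrite /exit_rate.
rewrite (eq_esum (b := fun y => (\sum_(j < d)
    ((if label_incr (xi u) x j y then q else 0)%:E +
    (if label_decr (xi u) x j y then 1 else 0)%:E))%E)); last first.
  by move=> y _; rewrite label_rateE -sumEFin; apply: eq_bigr.
rewrite esum_sum; last first.
  by move=> y j _ _; rewrite adde_ge0//; case: ifP.
have -> : (q + 1) *+ d = \sum_(j < d) (q + 1) by rewrite sumr_const card_ord.
rewrite -sumEFin; apply: lee_sum => j _.
rewrite esumD; last 2 first.
- by move=> y _; case: ifP.
- by move=> y _; case: ifP.
rewrite EFinD leeD//; apply: esum_unique_le => // y y'.
- move=> /and3P[_ /eqP yE _] /and3P[_ /eqP yE' _].
  by apply: val_inj; rewrite yE yE'.
- move=> /and4P[_ _ /eqP yE _] /and4P[_ _ /eqP yE' _].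
  by apply: val_inj; rewrite yE yE'.
Qed.
End LabelRates.

(** * Total mass of the product formula *)

Section ProductFormula.
Context {R : realType} (q : R).
Hypotheses (q0 : 0 < q) (q1 : q < 1).

(** The remaining coordinates are measured from the site after the first one. The two components are
    then unconstrained by each other, and the weight factorizes. *)
Definition shift_cons d (p : nat * Zplus d) : d.+1.-tuple nat :=
  [tuple of p.1 :: map (fun n => n + p.1.+1)%N (val p.2)].

Lemma shift_cons_sorted d (p : nat * Zplus d) : sorted ltn (shift_cons p).
Proof.
rewrite /= path_min_sorted.
  rewrite sorted_map; apply: sub_sorted (valP p.2) => m n /=.
  by rewrite ltn_add2r.
by apply/allP => _ /mapP[n _ ->]; rewrite /= addnS ltnS leq_addl.
Qed.

Definition Zplus_cons d (p : nat * Zplus d) : Zplus d.+1 :=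
  exist _ (shift_cons p) (shift_cons_sorted p).

Lemma Zplus_cons_bij d :
  set_bij [set: nat * Zplus d] [set: Zplus d.+1] (@Zplus_cons d).
Proof.
split=> // [[a y] [b z] _ _ /(congr1 (fun x => val (val x))) /= [-> /inj_map yz]|x _].
  congr (_, _); apply/val_inj/val_inj/yz => m n /eqP.
  by rewrite eqn_add2r => /eqP.
case: x => t; case/tupleP: t => a t xs.
(* All later entries exceed [a], so the truncated subtraction of [a.+1] below is exact. *)
have am n : n \in val t -> (a < n)%N.
  by move: xs; rewrite /= => /(order_path_min ltn_trans)/allP /[apply].
pose s : d.-tuple nat := [tuple of map (subn^~ a.+1) t].
have ys : sorted ltn s.
  rewrite /= sorted_map; apply: (sub_in_sorted (P := mem t)) (path_sorted xs).
    by move=> m n /am /= + /am; lia.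
  exact/allP.
exists (a, exist (fun y : d.-tuple nat => is_true (sorted ltn y)) s ys) => //.
apply/val_inj/val_inj => /=; congr cons.
rewrite -map_comp map_id_in// => n /am /=; lia.
Qed.

(** The shift adds [d.+1 * a + d] to the coordinate sum, and [d] is exactly the increase of
    [d * (d - 1) / 2]. What remains is a geometric weight of ratio [q ^+ d.+1] in [a]. *)
Lemma label_pi_cons d a (y : Zplus d) :
  label_pi q (Zplus_cons (a, y)) =
  (1 - q ^+ d.+1) * q ^+ d.+1 ^+ a * label_pi q y.
Proof.
rewrite /label_pi big_nat_recr//= [X in X * _ = _]mulrC -!mulrA; congr (_ * _).
rewrite [RHS]mulrCA; congr (_ * _).
have -> : (\sum_(i < d.+1) tnth (shift_cons (a, y)) i =
    d.+1 * a + d + \sum_(i < d) tnth (val y) i)%N.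
  rewrite big_ord_recl tnth0 /=.
  under eq_bigr do rewrite tnthS tnth_map.
  by rewrite big_split/= sum_nat_const card_ord; lia.
have -> : ((d.+1 * (d.+1 - 1)) %/ 2 = d + (d * (d - 1)) %/ 2)%N.
  rewrite -divnMDl//; congr (_ %/ _)%N; case: (d) => // n; rewrite !subn1 /=; nia.
rewrite -exprM exprnP -expfzDr ?gt_eqF//.
by congr (q ^ _); rewrite !PoszD; ring.
Qed.

Lemma label_pi_ge0 d (x : Zplus d) : 0 <= label_pi q x.
Proof.
rewrite mulr_ge0//; last exact/exprz_ge0/ltW.
apply: prodr_ge0 => i _; rewrite subr_ge0.
by rewrite exprn_ile1// ltW.
Qed.

Lemma esum_geometric (p : R) : 0 < p -> p < 1 ->
  (\esum_(a in [set: nat]) ((1 - p) * p ^+ a)%:E = 1)%E.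
Proof.
move=> p0 p1; rewrite -nneseries_esumT; last first.
  by move=> n; rewrite lee_fin mulr_ge0 ?subr_ge0 ?exprn_ge0// ltW.
apply/cvg_lim; first exact: ereal_hausdorff.
have np : `|p| < 1 by rewrite ger0_norm ?ltW.
have := @cvg_geometric_series _ (1 - p) _ np.
rewrite divff ?subr_eq0 ?gt_eqF// => h.
rewrite (_ : (fun n => _) = EFin \o series (geometric (1 - p) p)).
  by apply: cvg_EFin => //; exact: nearW.
by apply/funext => n; rewrite /= sumEFin.
Qed.

(** Induction on [d]: the first coordinate is geometric and independent of the shifted rest, which
    has the weights for [d]. *)
Lemma esum_label_pi d : (\esum_(x in [set: Zplus d]) (label_pi q x)%:E = 1)%E.
Proof.
elim: d => [|d IH].
  have x0 : Zplus 0 by exists [tuple].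
  rewrite (_ : [set: Zplus 0] = [set x0]).
    rewrite esum_set1 ?lee_fin ?label_pi_ge0//.
    by rewrite /label_pi big_geq// big_ord0 mul0n div0n subrr expr0z mulr1.
  apply/seteqP; split=> // x _.
  by apply/val_inj; rewrite (tuple0 (val x)) (tuple0 (val x0)).
rewrite (@reindex_esum _ _ _ _ _ _ _ (Zplus_cons_bij d)).
rewrite (_ : [set: nat * Zplus d] = [set: nat] `*`` (fun=> [set: Zplus d])); last first.
  by apply/seteqP; split.
rewrite -(esum_esum (a := fun a y => (label_pi q (Zplus_cons (a, y)))%:E)); last first.
  by move=> *; rewrite lee_fin label_pi_ge0.
have p0 : 0 < q ^+ d.+1 by rewrite exprn_gt0.
have p1 : q ^+ d.+1 < 1 by rewrite exprn_ilt1// ltW.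
rewrite -(esum_geometric p0 p1); apply: eq_esum => a _.
rewrite (eq_esum (b := fun y =>
    (((1 - q ^+ d.+1) * q ^+ d.+1 ^+ a)%:E * (label_pi q y)%:E)%E)).
  rewrite ge0_esumZl ?IH ?mule1// => [y|]; first by rewrite lee_fin label_pi_ge0.
  by rewrite mulr_ge0 ?exprn_ge0 ?subr_ge0// ltW.
by move=> y _; rewrite label_pi_cons EFinM.
Qed.
End ProductFormula.

(** * Stationarity *)
Section Fibers.
Context {R : realType} {d : measure_display} {T : measurableType d} {S : countType}.
Variables (P : probability T R) (X : T -> S).
Hypothesis mX : forall y, measurable [set w | X w = y].
Local Open Scope ereal_scope.

(** The sample space is partitioned by the value of [X]; at an outcome [w] only the term [y = X w]
    is nonzero. *)
Lemma ge0_integral_fibers (f : S -> T -> \bar R) :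
  (forall y, measurable_fun [set: T] (f y)) -> (forall y w, 0 <= f y w) ->
  \int[P]_w f (X w) w = \esum_(y in [set: S]) \int[P]_(w in [set w | X w = y]) f y w.
Proof.
move=> mf f0; pose h y := f y \_ [set w | X w = y].
have h0 y w : 0 <= h y w by rewrite /h patchE; case: ifP.
rewrite (eq_esum (b := fun y => \int[P]_w h y w)); last first.
  by move=> y _; rewrite [LHS]integral_mkcond.
rewrite -ge0_integral_esum//; last first.
  by move=> y; apply/(measurable_restrictT _ (mX y)); exact: measurable_funTS.
apply: eq_integral => w _.
rewrite (eq_esum (b := fun y => if y \in [set X w] then f y w else 0)).
  by rewrite -esum_mkcond esum_set1.
move=> y _; rewrite /h patchE.
have [<-|Xy] := eqVneq (X w) y; first by rewrite !mem_set.
rewrite !memNset// => /= yX; by rewrite yX eqxx in Xy.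
Qed.

Lemma esum_law : \esum_(y in [set: S]) P [set w | X w = y] = 1.
Proof.
transitivity (\int[P]_w (cst 1 w)); last first.
  by rewrite integral_cst// mul1e; exact: probability_setT.
rewrite (ge0_integral_fibers (f := fun=> cst 1))//.
by apply: eq_esum => y _; rewrite integral_cst// mul1e.
Qed.
End Fibers.

(** The terms other than [y] have a finite sum under [b], which dominates their sum under [a];
    cancelling it gives [b y <= a y]. *)
Lemma esum_dominated_eq (R : realType) (S : choiceType) (a b : S -> \bar R) y :
  (forall z, 0 <= a z)%E -> (forall z, a z <= b z)%E ->
  (\esum_(z in [set: S]) a z = \esum_(z in [set: S]) b z)%E ->
  (\esum_(z in [set: S]) b z < +oo)%E -> a y = b y.
Proof.
move=> a0 ab; have b0 z : (0 <= b z)%E by rewrite (le_trans (a0 z)).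
have IDy (c : S -> \bar R) : (forall z, 0 <= c z)%E -> (\esum_(z in [set: S]) c z =
    c y + \esum_(z in ~` [set y]) c z)%E.
  by move=> c0; rewrite (esumID [set y])// !setTI esum_set1.
rewrite !IDy// => eab bfin.
apply/eqP; rewrite eq_le ab/=.
set rb := (\esum_(z in ~` [set y]) b z)%E in eab bfin.
have rb0 : (0 <= rb)%E by apply: esum_ge0.
have rbfin : rb \is a fin_num.
  rewrite ge0_fin_numE//; apply: le_lt_trans bfin.
  by rewrite leeDr.
rewrite -(leeD2rE _ _ rbfin) -eab leeD2l//.
by apply: le_esum => z _; exact: ab.
Qed.

(** * Bounding the law at time t by the product formula *)

Section LawBound.
Context {R : realType} {q : R} {d : nat}.
Hypotheses (q0 : 0 < q) (q1 : q < 1).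
Context {d' : measure_display} {T : measurableType d'}.
Variables (P : probability T R) (xi : R -> T -> Omega) (x : R -> T -> Zplus d).
Hypotheses (xi_asep : is_asep P q xi) (x_label : is_label_process P q xi x).
Hypotheses (x_indep : indep_of_process P (x 0) xi).
Hypothesis (x_law : has_law P (x 0) (@label_pi R q d)).

Let G := events_of xi [set u | 0 <= u].
Let T' := g_sigma_algebraType G.
(* Extending the background to negative times by its state at time 0 makes the
   rates jointly measurable on all of [T' * R]. *)
Let r (w : T') (u : R) := @label_rate R q d (xi (Num.max u 0) w).

Let G_measurable : G `<=` measurable.
Proof. by have [mxi _ _] := xi_asep => A [u [z [u0 ->]]]; exact: mxi. Qed.

Let r0 w u y z : 0 <= r w u y z.
Proof. exact/label_rate_ge0/ltW. Qed.

(** Measurability is with respect to the background's own sigma-algebra [T'], the one from which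
    [x 0] is independent. *)
Let mr y z : measurable_fun [set: T' * R] (fun p => r p.1 p.2 y z).
Proof.
have [_ pxi _] := xi_asep.
apply: (@measurable_jump_path R _ T' _ countable_Omega xi
  (fun z' => label_rate q z' y z)) => // u z' u0.
by apply: sub_sigma_algebra; exists u, z'.
Qed.

Lemma law_le t y : 0 <= t -> (P [set w | x t w = y] <= (label_pi q y)%:E)%E.
Proof.
move=> t0.
(* Conditioning at time 0 over the whole sample space expresses the law at [t] as a mean of
   transition probabilities from [x 0]. *)
have [mx _ /(_ 0 t y setT)] := x_label.
rewrite setTI => ->//; last exact: (@measurableT _ (g_sigma_algebraType _)).
pose f z (w : T') := trans_prob (r w) 0 t z y.
have f0 z w : (0 <= f z w)%E.
  by apply: nneseries_ge0 => n _ _; exact: njump_prob_ge0.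
have mf' z : measurable_fun [set: T'] (f z).
  exact: (measurable_trans_prob (S := {x : d.-tuple nat | sorted ltn x}) r0 mr).
have mf z : measurable_fun [set: T] (f z).
  move=> _ B mB; apply: (smallest_sub _ G_measurable); last exact: mf'.
  exact: sigma_algebra_measurable.
rewrite (_ : (\int[P]_w _)%E = (\int[P]_w f (x 0 w) w)%E); last first.
  apply: eq_integral => w _; apply: eq_eseriesr => n _.
  by apply: eq_njump_prob => u u0; rewrite /r max_l.
rewrite (ge0_integral_fibers P (S := {x : d.-tuple nat | sorted ltn x}))//; last first.
  by move=> z; exact: mx.
(* The transition probability from a fixed [z] depends on the background alone, so independence
   pulls out the probability of [x 0 = z]. *)
rewrite (eq_esum (b := fun z => \int[P]_w ((label_pi q z)%:E * f z w)))%E; last first.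
  move=> z _; rewrite (indep_integral (G := G))//; [|exact: mx|exact: x_indep].
  by rewrite x_law -ge0_integralZl// lee_fin label_pi_ge0.
rewrite -(ge0_integral_esum P (D := setT)
  (S := {x : d.-tuple nat | sorted ltn x}))//; last 2 first.
- by move=> z; exact: emeasurable_funM.
- by move=> z w; rewrite mule_ge0 ?lee_fin ?label_pi_ge0.
have -> : (label_pi q y)%:E = (\int[P]_w (cst (label_pi q y)%:E w))%E.
  by rewrite integral_cst// [X in (_ * X)%E]probability_setT mule1.
apply: ge0_le_integral => //.
- by move=> w _; apply: esum_ge0 => z _; rewrite mule_ge0 ?lee_fin ?label_pi_ge0.
- apply: (measurable_fun_esum (S := {x : d.-tuple nat | sorted ltn x})) => [z|z w].
    exact: emeasurable_funM.
  by rewrite mule_ge0 ?lee_fin ?label_pi_ge0.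
(* With the background outcome [w] fixed, the rates are deterministic functions of time and
   subinvariance applies pointwise. *)
- move=> w _.
  apply: (trans_prob_subinvariance (S := {x : d.-tuple nat | sorted ltn x})
    (C := fun=> (q + 1) *+ d)) => //.
  + by move=> z z'; exact: (measurable_fun_pair2 _ (mr z z')).
  + by move=> u z; apply: label_exit_le; exact: ltW.
  + exact: label_pi_ge0.
  + by move=> u z z'; apply: label_rate_balance; rewrite gt_eqF.
Qed.
End LawBound.

Theorem theorem3p4 (R : realType) (q : R) (hq0 : 0 < q) (hq1 : q < 1)
    (d : nat) (hd : (1 <= d)%N) :
  reversible_stationary q (@label_pi R q d).
Proof.
split.
- by split; [exact: label_pi_ge0|exact: esum_label_pi].
- by move=> xi x y; apply: label_rate_balance; rewrite gt_eqF.
- move=> d' T P xi x hxi hx hind hlaw t t0 y.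
  have [mx _ _] := hx.
  apply: (esum_dominated_eq (a := fun y => P [set w | x t w = y])
    (b := fun y => (label_pi q y)%:E)) => //.
  + by move=> z; exact: (law_le hq0 hq1 hxi hx hind hlaw).
  + rewrite esum_label_pi//.
    by apply: (esum_law (S := {x : d.-tuple nat | sorted ltn x})) => z; exact: mx.
  + by rewrite esum_label_pi// ltry.
Qed.
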